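(* Let $s,t$ be positive integers with $t>s$ and $t>\frac{s^2}{4}$, and let $y$ be a positive cubic number (real algebraic of degree $3$) with $-1+ty+sy^2+y^3=0$. Let $f,r$ be nonnegative integers such that $y^2+fy<y\sqrt{|f^3-sf^2+ft+1|}$ and $y^2+fy<1$, and let $\vec v_{s,t,f,r}=(y^2+fy+r,\,y,\,1)^T$. Then the homogeneous AJPA expansion of $\vec v_{s,t,f,r}$ is \[ (A_{3,r,0},A_{2,f,t},A_{1,t,s},A_{3,t,s},A_{2,s,t},A_{1,t,s},A_{3,t,s},A_{2,s,t},\dots) \] (i.e. $A_{3,r,0}$, $A_{2,f,t}$ followed by the periodic repetition of $A_{1,t,s},A_{3,t,s},A_{2,s,t}$) if $r>0$, and \[ (A_{2,f,t},A_{1,t,s},A_{3,t,s},A_{2,s,t},A_{1,t,s},A_{3,t,s},A_{2,s,t},\dots) \] if $r=0$.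
   Context: Let $K$ be a cubic number field, $N$ the norm $N_{K|\mathbb{Q}}$, and write vectors as $(v_1,v_2,v_0)^T\in(K\cap\mathbb{R}_{>0})^3$. For nonnegative integers $j,k$ define the sets: $I_{1,j,k}$: $\lfloor v_2/v_1\rfloor=j$, $\lfloor v_0/v_1\rfloor=k$, $v_p>v_1$, $v_p>v_q$, and $v_1/\sqrt{|N(v_1)|}>v_q/\sqrt{|N(v_q)|}$ for $(p,q)=(0,2)$ or $(2,0)$; $I_{2,j,k}$: $\lfloor v_1/v_2\rfloor=j$, $\lfloor v_0/v_2\rfloor=k$, $v_p>v_2$, $v_p>v_q$, $v_2/\sqrt{|N(v_2)|}>v_q/\sqrt{|N(v_q)|}$ for $(p,q)=(0,1)$ or $(1,0)$; $I_{3,j,k}$: $\lfloor v_1/v_0\rfloor=j$, $\lfloor v_2/v_0\rfloor=k$, $v_p>v_0$, $v_p>v_q$, $v_0/\sqrt{|N(v_0)|}>v_q/\sqrt{|N(v_q)|}$ for $(p,q)=(2,1)$ or $(1,2)$. Let $T_{ab}$ ($a\neq b$) be the $3\times3$ matrix with $1$'s on the diagonal and at position $(a,b)$ and $0$ elsewhere (positions $1,2,3$ correspond to coordinates $v_1,v_2,v_0$). Set $A_{1,j,k}=T_{21}^jT_{31}^k$, $A_{2,j,k}=T_{12}^jT_{32}^k$, $A_{3,j,k}=T_{13}^jT_{23}^k$. The homogeneous AJPA expansion of $\vec v$ is produced as follows: $\vec v^{(0)}=\vec v$; at step $i$, if $\vec v^{(i)}\in I_{a,j,k}$ set $A^{(i)}=A_{a,j,k}$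 and $\vec v^{(i+1)}=A_{a,j,k}^{-1}\vec v^{(i)}$ (stop if $\vec v^{(i)}$ lies in no such set); the expansion is the sequence $(A^{(i)})_{i\ge0}$. *)

(* Defs.v *)
From HB Require Import structures.
From mathcomp Require Import all_boot all_order all_algebra all_field.
From mathcomp Require Import reals.

Set Implicit Arguments.
Unset Strict Implicit.
Unset Printing Implicit Defensive.

Import Order.TTheory GRing.Theory Num.Theory.
Local Open Scope ring_scope.

(* N_{K|Q}(x): the determinant of multiplication by x on the Q-space K. *)
Definition normKQ (K : fieldExtType rat) (x : K) : rat :=
  \det (passmx.mxof (vbasis {:K}) (vbasis {:K}) (amull x)).

(* Matrix positions 1, 2, 3 are the indices 0, 1, 2 of 'I_3 and carry the
   coordinates v_1, v_2, v_0, in this order. *)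
Definition pos1 : 'I_3 := @Ordinal 3 0 isT.
Definition pos2 : 'I_3 := @Ordinal 3 1 isT.
Definition pos3 : 'I_3 := @Ordinal 3 2 isT.

Definition vec3 (K : Type) (v1 v2 v0 : K) : 'cV[K]_3 :=
  \col_i nth v0 [:: v1; v2; v0] i.

(* The first index of I_{a,j,k} and A_{a,j,k}. *)
Inductive branch := B1 | B2 | B3.

Section AJPA.
Variables (R : realType) (K : fieldExtType rat) (iota : {rmorphism K -> R}).

Definition scaled (x : K) : R := iota x / Num.sqrt `|ratr (normKQ x)|.

Definition dominates (x p q : K) : Prop :=
  [/\ iota p > iota x, iota p > iota q & scaled x > scaled q].

(* The shape shared by the three sets I_{a,j,k}: x is the coordinate of
   index a, and y, z are the other two in the order of the floors j, k. *)
Definition I_cond (x y z : K) (j k : nat) : Prop :=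
  [/\ Num.floor (iota y / iota x) = j%:Z,
      Num.floor (iota z / iota x) = k%:Z
    & dominates x z y \/ dominates x y z].

Definition I_set (a : branch) (j k : nat) (v : 'cV[K]_3) : Prop :=
  let v1 := v pos1 0 in let v2 := v pos2 0 in let v0 := v pos3 0 in
  [/\ 0 < iota v1, 0 < iota v2, 0 < iota v0
    & match a with
      | B1 => I_cond v1 v2 v0 j k
      | B2 => I_cond v2 v1 v0 j k
      | B3 => I_cond v0 v1 v2 j k
      end].

Definition T_mx (a b : 'I_3) : 'M[K]_3 := 1 + delta_mx a b.

Definition A_mx (a : branch) (j k : nat) : 'M[K]_3 :=
  match a with
  | B1 => T_mx pos2 pos1 ^+ j *m T_mx pos3 pos1 ^+ k
  | B2 => T_mx pos1 pos2 ^+ j *m T_mx pos3 pos2 ^+ k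
  | B3 => T_mx pos1 pos3 ^+ j *m T_mx pos2 pos3 ^+ k
  end.

(* AJPA_step w A w': from the state w (None once the algorithm has stopped)
   one step outputs A (None for no output) and reaches the state w'. *)
Inductive AJPA_step :
    option 'cV[K]_3 -> option 'M[K]_3 -> option 'cV[K]_3 -> Prop :=
  | AJPA_next v a j k : I_set a j k v ->
      AJPA_step (Some v) (Some (A_mx a j k)) (Some (invmx (A_mx a j k) *m v))
  | AJPA_stop v : (forall a j k, ~ I_set a j k v) ->
      AJPA_step (Some v) None None
  | AJPA_stopped : AJPA_step None None None.

(* A finite or infinite expansion is a function nat -> option 'M_3, equal to
   None from the moment the algorithm stops. *)
Definition AJPA_expansion (v : 'cV[K]_3) (A : nat -> option 'M[K]_3) : Prop :=
  exists w : nat -> option 'cV[K]_3,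
    w 0%N = Some v /\ forall i, AJPA_step (w i) (A i) (w i.+1).

End AJPA.

Arguments A_mx {K} a j k.

(* The infinite sequence pre, per, per, per, ... (per nonempty). *)
Definition eventually_periodic (T : nmodType) (pre per : seq T) (i : nat) : T :=
  if (i < size pre)%N then pre`_i else per`_((i - size pre) %% size per).

(* Main.v *)
Require Import Defs.
From HB Require Import structures.
From mathcomp Require Import all_boot all_order all_algebra all_field.
From mathcomp Require Import reals ring lra.

Set Implicit Arguments.
Unset Strict Implicit.
Unset Printing Implicit Defensive.

Import Order.TTheory GRing.Theory Num.Theory.
Local Open Scope ring_scope.

(** The root satisfies 1 = y (y^2 + s y + t) with 0 <= y^2 + s y < 1, so
    1/y has floor t, and subtracting t y from 1 leaves y (y^2 + s y).  Hence
    the first step of type B2 turns (y^2 + f y, y, 1) into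
    y (y, 1, y^2 + s y), and each later step multiplies by y and rotates the
    coordinates cyclically.  Since N(y) = 1 and
    N(y + g) = g^3 - s g^2 + t g + 1, the comparison of scaled coordinates
    amounts to y + g < sqrt |N(y + g)|; for g = f this is a hypothesis, and
    for g = s it reads (y + s)^2 < s t + 1, which follows from t > s.  The
    sets I_{a,j,k} are pairwise disjoint, so the expansion is unique. *)

(** * The norm as a determinant in any basis *)

Section Norm.
Import passmx.
Variable K : fieldExtType rat.
Local Notation mxK x := (mxof (vbasis {:K}) (vbasis {:K}) (amull x)).

Lemma normKQM (x y : K) : normKQ (x * y) = normKQ x * normKQ y.
Proof.
rewrite /normKQ mulrC -det_mulmx; congr (\det _).
rewrite -mxof_comp ?vbasisP //; congr (mxof _ _ _).
by apply/lfunP => z; rewrite comp_lfunE !lfunE /= mulrA.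
Qed.

Lemma normKQ1 : normKQ (1 : K) = 1.
Proof.
by rewrite /normKQ amull1 mxof1 ?det1 // (basis_free (vbasisP _)).
Qed.

Lemma normKQX (x : K) n : normKQ (x ^+ n) = normKQ x ^+ n.
Proof.
by elim: n => [|n IHn]; rewrite ?expr0 ?normKQ1 // !exprS normKQM IHn.
Qed.

Lemma normKQ_det n (e : 'I_n -> K) (M : 'M[rat]_n) x :
    \dim {:K} = n ->
    (forall u : 'rV_n, \sum_i u 0 i *: e i = 0 -> u = 0) ->
    (forall i, x * e i = \sum_j M i j *: e j) ->
  normKQ x = \det M.
Proof.
move=> dimK; move: e M; case: n / dimK => e M free_e xe.
set n := \dim {:K} in e M free_e xe *.
pose P : 'M_n := \matrix_i rVof (vbasis {:K}) (e i).
have mulP m (u : 'M_(m, n)) i :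
    row i (u *m P) = rVof (vbasis {:K}) (\sum_j u i j *: e j).
  rewrite row_mul mulmx_sum_row linear_sum; apply: eq_bigr => j _.
  by rewrite linearZ rowK mxE.
have unitP : P \in unitmx.
  rewrite -row_free_unit; apply: inj_row_free => u uP0; apply: free_e.
  apply/eqP; rewrite -(rVof_eq0 (vbasisP {:K})) -mulP uP0.
  by rewrite row0.
have PM : P *m mxK x = M *m P.
  apply/row_matrixP => i; rewrite mulP -xe row_mul rowK.
  by rewrite -rVof_app ?vbasisP // lfunE.
have detP : \det P != 0 by rewrite -unitfE -unitmxE.
apply: (mulfI detP); rewrite -!det_mulmx PM det_mulmx mulrC.
by rewrite -det_mulmx.
Qed.
End Norm.


(** * The norm of a translate of a cubic generator *)

Lemma adjoin_free (F : fieldType) (L : fieldExtType F) (y : L) n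
    (u : 'rV[F]_n) :
    (n <= adjoin_degree 1%AS y)%N -> \sum_i u 0 i *: y ^+ i = 0 -> u = 0.
Proof.
case: n u => [|n] u len u0; first by rewrite thinmx0.
(* A relation among low powers of [y] is a polynomial with root [y] of degree below that of [y],
   hence zero. *)
pose p := \poly_(i < n.+1) ((u 0 (inord i))%:A : L).
have py0 : root p y.
  apply/rootP; rewrite horner_poly -[RHS]u0.
  by apply: eq_bigr => i _; rewrite inord_val mulr_algl.
have p0 : p = 0.
  apply/eqP; rewrite -(@root_small_adjoin_poly _ _ 1%AS y) //.
    by apply/polyOver_poly => i _; rewrite rpredZ ?mem1v.
  exact: leq_trans (size_poly _ _) len.
apply/rowP => i; rewrite mxE; have := congr1 (fun q : {poly L} => q`_i) p0.
rewrite coef_poly coef0 ltn_ord inord_val => /eqP.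
by rewrite scaler_eq0 oner_eq0 orbF => /eqP.
Qed.

Lemma normKQ_cubic (K : fieldExtType rat) (a b c z : rat) (y : K) :
    \dim {:K} = 3 -> adjoin_degree 1%AS y = 3 ->
    y ^+ 3 + a%:A * y ^+ 2 + b%:A * y + c%:A = 0 ->
  normKQ (y + z%:A) = z ^+ 3 - a * z ^+ 2 + b * z - c.
Proof.
move=> dimK degy y_root.
(* Rows: [y + z] times [1], [y], [y ^+ 2], where the last product is reduced by [y_root]. *)
pose M : 'M[rat]_3 := \matrix_(i, j)
  nth 0 (nth [::] [:: [:: z; 1; 0]; [:: 0; z; 1]; [:: - c; - b; z - a]] i) j.
rewrite (@normKQ_det _ _ (fun i : 'I_3 => y ^+ i) M) //.
- rewrite (expand_det_row _ 0) !big_ord_recl big_ord0 /cofactor.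
  rewrite !(expand_det_row _ 0) !big_ord_recl !big_ord0 /cofactor !det_mx11.
  rewrite !mxE /=; ring.
- by move=> u; apply: adjoin_free; rewrite degy.
- move=> i; rewrite !big_ord_recl big_ord0.
  case: i => [[|[|[|//]]] ltm]; rewrite !mxE /=;
    rewrite -![_ *: y ^+ _]mulr_algl /bump /=;
    rewrite !(scaleNr, scalerBl, scale1r, scale0r); try ring.
  by rewrite -[LHS]subr0 -[X in _ - X]y_root; ring.
Qed.

#[local] Arguments A_mx : simpl never.

(** * Determinism of the algorithm and uniqueness of expansions *)

Section Expansion.
Variables (R : realType) (K : fieldExtType rat) (iota : {rmorphism K -> R}).
Implicit Types (v : 'cV[K]_3) (a : branch).

Lemma I_condC (x y z : K) j k :
  I_cond iota x y z j k -> I_cond iota x z y k j.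
Proof. by case=> fy fz [] dom; split=> //; [right | left]. Qed.

Lemma I_cond_inj (x y z : K) j k j' k' :
  I_cond iota x y z j k -> I_cond iota x y z j' k' -> j = j' /\ k = k'.
Proof.
case=> fy fz _ [fy' fz' _].
by split; apply: (can_inj absz_nat); rewrite -?fy -?fz ?fy' ?fz'.
Qed.

(** A pivot is never the largest coordinate, so two distinct pivots leave [z] as the largest; each
    would then need a scaled value above the other's. *)
Lemma I_cond_pivot (x y z : K) j k j' k' :
  I_cond iota x y z j k -> ~ I_cond iota y x z j' k'.
Proof.
move=> [_ _ d] [_ _ d'].
case: d => -[zx zy xy]; case: d' => -[h1 h2 h3].
- by move: xy; rewrite ltNge (ltW h3).
- by move: zx; rewrite ltNge (ltW h2).
- by move: zy; rewrite ltNge (ltW h1).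
- by move: zx; rewrite ltNge (ltW h1).
Qed.

Lemma I_set_inj a j k a' j' k' v :
  I_set iota a j k v -> I_set iota a' j' k' v -> [/\ a = a', j = j' & k = k'].
Proof.
case=> _ _ _ h [_ _ _]; case: a h => h; case: a' => h';
  try by case: (I_cond_inj h h').
- by case: (I_cond_pivot h h').
- by case: (I_cond_pivot (I_condC h) h').
- by case: (I_cond_pivot h h').
- by case: (I_cond_pivot (I_condC h) (I_condC h')).
- by case: (I_cond_pivot h (I_condC h')).
- by case: (I_cond_pivot (I_condC h) (I_condC h')).
Qed.

(** Off the diagonal [delta_mx a b] squares to zero, so the power is linear in [n]. *)
Lemma T_mxX (a b : 'I_3) n :
  a != b -> T_mx K a b ^+ n = 1 + n%:R *: delta_mx a b.
Proof.
move=> neq_ab; rewrite scaler_nat; elim: n => [|n IHn].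
  by rewrite mulr0n addr0.
rewrite exprSr IHn /T_mx mulrDr mulr1 mulrDl mul1r mulrnAl.
rewrite -[delta_mx a b * _]/(_ *m _) mul_delta_mx_0 1?eq_sym //.
by rewrite mul0rn addr0 mulrSr addrA.
Qed.

Lemma T_mx_unit (a b : 'I_3) : a != b -> T_mx K a b \is a GRing.unit.
Proof.
move=> neq_ab; apply/unitrP; exists (1 - delta_mx a b).
rewrite /T_mx !(mulrDr, mulrDl, mulr1, mul1r, mulrN, mulNr).
rewrite -[delta_mx a b * _]/(_ *m _) mul_delta_mx_0 1?eq_sym //.
by rewrite oppr0 !addr0 subrK addrK.
Qed.

Lemma A_mx_unit a j k : (A_mx a j k : 'M[K]_3) \in unitmx.
Proof. by case: a; rewrite unitmx_mul !unitrX //; exact: T_mx_unit. Qed.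

Lemma A_mxE a j k (x y z : K) :
  A_mx a j k *m vec3 x y z =
  match a with
  | B1 => vec3 x (y + j%:R * x) (z + k%:R * x)
  | B2 => vec3 (x + j%:R * y) y (z + k%:R * y)
  | B3 => vec3 (x + j%:R * z) (y + k%:R * z) z
  end.
Proof.
apply/colP => i; case: a; rewrite /A_mx !T_mxX // !mxE !big_ord_recl big_ord0;
  rewrite !mxE !big_ord_recl !big_ord0 !mxE; case: i => [[|[|[|//]]] lti];
  rewrite /= ?eqE /= ?(mulr1n, mulr0n, mul0rn); ring.
Qed.

(** Reduces an expansion to guessing its states [w], checked without inverting matrices; [I_set_inj]
    makes any other run follow the same states. *)
Lemma AJPA_expansionE (w : nat -> 'cV[K]_3) (B : nat -> 'M[K]_3) :
    (forall i, exists a j k,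
      [/\ I_set iota a j k (w i), B i = A_mx a j k & B i *m w i.+1 = w i]) ->
  forall A, AJPA_expansion iota (w 0) A <-> forall i, A i = Some (B i).
Proof.
move=> wB A; split=> [[u [u0 uA]] i | AB]; last first.
  exists (Some \o w); split=> // i; rewrite AB /=.
  have [a [j [k [Iw -> wS]]]] := wB i.
  by rewrite -[w i.+1](mulKmx (A_mx_unit a j k)) wS; apply: AJPA_next.
suff [] : u i = Some (w i) /\ A i = Some (B i) by [].
have step n : u n = Some (w n) -> A n = Some (B n) /\ u n.+1 = Some (w n.+1).
  move=> un; have [a [j [k [Iw Bn wS]]]] := wB n.
  move: (uA n); rewrite un; move: (A n) (u n.+1) => An un1 stp.
  inversion stp as [v a' j' k' Iw' e1 e2 e3 | v nI e1 e2 e3 |].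
    have [-> -> ->] := I_set_inj Iw' Iw.
    by rewrite Bn; split=> //; rewrite -wS Bn mulKmx ?A_mx_unit.
  by case: (nI _ _ _ Iw).
suff ui : u i = Some (w i) by split=> //; have [] := step i ui.
by elim: i => // i IHi; have [] := step i IHi.
Qed.
End Expansion.

Lemma floor_addn (R : realType) (x : R) n :
  0 <= x < 1 -> Num.floor (x + n%:R) = n%:Z.
Proof.
case/andP=> x_ge0 x_lt1; apply: floor_def.
by rewrite intrD mulr1z -pmulrn lerDr x_ge0 addrC ltrD2l.
Qed.

(** * Bounds on the root, and the periodic orbit *)

Section Cubic.
Variables (R : realType) (K : fieldExtType rat) (iota : {rmorphism K -> R}).
Hypothesis cubicK : \dim {:K} = 3%N.
Variables (s t : nat).
Hypotheses (s_gt0 : (0 < s)%N) (lt_st : (s < t)%N).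
Variable y : K.
Hypotheses (y_gt0 : 0 < iota y) (cubic_y : adjoin_degree 1%AS y = 3%N)
  (y_root : - 1 + t%:R * y + s%:R * y ^+ 2 + y ^+ 3 = 0).

Lemma normKQ_root_addn g :
  normKQ (y + g%:R) = g%:R ^+ 3 - s%:R * g%:R ^+ 2 + g%:R * t%:R + 1.
Proof.
have -> : g%:R = (g%:R : rat)%:A :> K by rewrite scaler_nat.
rewrite (@normKQ_cubic _ s%:R t%:R (-1)) //; first by ring.
rewrite !scaler_nat scaleN1r -y_root; ring.
Qed.

Lemma normKQ_root : normKQ y = 1.
Proof. by rewrite -[y]addr0 (normKQ_root_addn 0); ring. Qed.

Lemma scaled_rootX n : scaled iota (y ^+ n) = iota y ^+ n.
Proof.
rewrite /scaled normKQX normKQ_root expr1n rmorph1 normr1 sqrtr1 divr1.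
exact: rmorphXn.
Qed.

Lemma iota_root : iota y * (iota y ^+ 2 + s%:R * iota y + t%:R) = 1.
Proof.
have := congr1 iota y_root.
by rewrite !rmorphD !rmorphXn !rmorphM rmorphN1 !rmorph_nat rmorph0 /=; lra.
Qed.

Lemma iota_sqr_add g :
  iota (y ^+ 2 + g%:R * y) = iota y * (iota y + g%:R).
Proof. by rewrite rmorphD rmorphXn rmorphM rmorph_nat /=; ring. Qed.

Let s_ge1 : 1 <= s%:R :> R.
Proof. by rewrite ler1n. Qed.

Let t_ge : s%:R + 1 <= t%:R :> R.
Proof. by rewrite natr1 ler_nat. Qed.

Lemma iota_root_lt1 : iota y < 1.
Proof. have := iota_root; have := s_ge1; have := t_ge; nra. Qed.

(** As [y < 1], [y^2 + s y < (s + 1) y <= t y < 1]. *)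
Lemma iota_root_tail_lt1 : iota (y ^+ 2 + s%:R * y) < 1.
Proof.
rewrite iota_sqr_add.
have := iota_root; have := s_ge1; have := t_ge; have := iota_root_lt1; nra.
Qed.

(** Serves both the step before the period ([n = 0], [g = f]) and every periodic step ([g = s]): the
    factor [y ^+ n] cancels in ratios and has norm 1. *)
Lemma I_cond_root n g :
    iota (y ^+ 2 + g%:R * y) <
      iota y * Num.sqrt `|g%:R ^+ 3 - s%:R * g%:R ^+ 2 + g%:R * t%:R + 1| ->
    iota (y ^+ 2 + g%:R * y) < 1 ->
  I_cond iota (y ^+ n * y) (y ^+ n * (y ^+ 2 + g%:R * y)) (y ^+ n) g t.
Proof.
move=> lt_norm lt_1.
have yn_gt0 : 0 < iota (y ^+ n) by rewrite rmorphXn exprn_gt0.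
have y_neq0 : iota y != 0 by rewrite gt_eqF.
have yn_neq0 : iota (y ^+ n) != 0 by rewrite gt_eqF.
have y1 := iota_root_lt1; have := iota_root_tail_lt1.
rewrite iota_sqr_add => y2; have yr := iota_root.
rewrite /I_cond ![iota (y ^+ n * _)]rmorphM /=; split.
- rewrite iota_sqr_add -mulf_div divff // mul1r mulrAC divff // mul1r.
  by rewrite floor_addn // ltW.
- have -> : iota (y ^+ n) / (iota (y ^+ n) * iota y) =
            iota y * (iota y + s%:R) + t%:R.
    rewrite invfM mulrA divff // mul1r; apply: (mulfI y_neq0).
    by rewrite divff // -[LHS]yr; ring.
  by rewrite floor_addn // y2 mulr_ge0 ?addr_ge0 ?ler0n // ltW.
left; split; rewrite ?[iota (y ^+ n * _)]rmorphM /=.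
- by rewrite gtr_pMr.
- by rewrite gtr_pMr.
rewrite -exprSr scaled_rootX.
have -> : y ^+ n * (y ^+ 2 + g%:R * y) = y ^+ n.+1 * (y + g%:R).
  by rewrite [y ^+ n.+1]exprSr; ring.
rewrite /scaled normKQM normKQX normKQ_root expr1n mul1r normKQ_root_addn.
rewrite !(rmorphD, rmorphN, rmorphXn, rmorphM, rmorph_nat, rmorph1) /=.
move: lt_norm; rewrite iota_sqr_add ltr_pM2l // => lt_norm.
(* A square root above [y + g > 0] is nonzero, so the denominator of the scaled value can be
   cleared. *)
have sq_gt0 :
    0 < Num.sqrt `|g%:R ^+ 3 - s%:R * g%:R ^+ 2 + g%:R * t%:R + 1 : R|.
  by apply: lt_trans lt_norm; rewrite ltr_wpDr ?ler0n.
by rewrite ltr_pdivrMr // ltr_pM2l ?exprn_gt0.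
Qed.

Lemma lt_norm_period :
  iota (y ^+ 2 + s%:R * y) <
    iota y * Num.sqrt `|s%:R ^+ 3 - s%:R * s%:R ^+ 2 + s%:R * t%:R + 1|.
Proof.
rewrite iota_sqr_add.
have -> : s%:R ^+ 3 - s%:R * s%:R ^+ 2 + s%:R * t%:R + 1 = s%:R * t%:R + 1 :> R.
  by ring.
have s1 := s_ge1; have ts := t_ge.
have := iota_root_tail_lt1; rewrite iota_sqr_add => y2.
have t1 : 0 < s%:R * t%:R + 1 :> R by nra.
rewrite ltr_pM2l // gtr0_norm //.
have ys_ge0 : 0 <= iota y + s%:R by rewrite addr_ge0 ?ler0n // ltW.
rewrite -[ltLHS](ger0_norm ys_ge0) -sqrtr_sqr ltr_sqrt //.
have y1 := iota_root_lt1.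
(* [(y + s)^2 = y (y + s) + s (y + s)]: the first term is below 1, the second below
   [s (s + 1) <= s t]. *)
nra.
Qed.

(* After the pre-period every state is, up to the order of its coordinates,
   y^(i+1) (y, 1, y^2 + s y). *)
Definition per_vec (i : nat) : 'cV[K]_3 :=
  let c := y ^+ i.+1 in
  nth 0 [:: vec3 (c * y) c (c * (y ^+ 2 + s%:R * y));
            vec3 c (c * (y ^+ 2 + s%:R * y)) (c * y);
            vec3 (c * (y ^+ 2 + s%:R * y)) (c * y) c] (i %% 3).

Definition per_mx : seq 'M[K]_3 := [:: A_mx B1 t s; A_mx B3 t s; A_mx B2 s t].

Lemma per_step i :
  exists a j k, [/\ I_set iota a j k (per_vec i),
    per_mx`_(i %% 3) = A_mx a j k &
    per_mx`_(i %% 3) *m per_vec i.+1 = per_vec i].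
Proof.
have I := I_cond_root i.+1 lt_norm_period iota_root_tail_lt1.
have c_gt0 : 0 < iota (y ^+ i.+1) by rewrite rmorphXn exprn_gt0.
have cy_gt0 : 0 < iota (y ^+ i.+1 * y) by rewrite rmorphM mulr_gt0.
have cz_gt0 : 0 < iota (y ^+ i.+1 * (y ^+ 2 + s%:R * y)).
  by rewrite rmorphM mulr_gt0 // iota_sqr_add mulr_gt0 ?ltr_wpDr ?ler0n.
(* [e2] and [e3] are the two coordinates that a periodic matrix changes, with [c = y ^+ i.+1]. *)
have e1 : y * (y ^+ 2 + s%:R * y) + t%:R * y = 1.
  rewrite -[RHS]addr0 -[X in _ = _ + X]y_root; ring.
have e2 c : c * y * (y ^+ 2 + s%:R * y) + t%:R * (c * y) = c.
  by rewrite -[RHS]mulr1 -[X in _ = _ * X]e1; ring.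
have e3 c : c * y * y + s%:R * (c * y) = c * (y ^+ 2 + s%:R * y) by ring.
have modS : (i.+1 %% 3 = (i %% 3).+1 %% 3)%N by rewrite -addn1 -modnDml addn1.
rewrite /per_vec modS.
have := ltn_pmod i (isT : 0 < 3)%N.
case: (i %% 3)%N => [|[|[|//]]] _ /=.
- exists B1, t, s; split=> //.
    (* [I] lists the floor [s] before [t]; the coordinate order of [B1] and [B3] reverses this. *)
    by rewrite /I_set !mxE /=; split=> //; apply: I_condC.
  by rewrite A_mxE ![y ^+ i.+2]exprSr e2 e3.
- exists B3, t, s; split=> //.
    by rewrite /I_set !mxE /=; split=> //; apply: I_condC.
  by rewrite A_mxE ![y ^+ i.+2]exprSr e2 e3.
- exists B2, s, t; split=> //; first by rewrite /I_set !mxE.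
  by rewrite A_mxE ![y ^+ i.+2]exprSr e2 e3.
Qed.

End Cubic.

Theorem theorem6p2 (R : realType) (K : fieldExtType rat)
    (iota : {rmorphism K -> R}) (cubicK : \dim {:K} = 3%N)
    (s t : nat) (s_gt0 : (0 < s)%N) (t_gt0 : (0 < t)%N)
    (lt_st : (s < t)%N) (lt_s2t : (s%:R ^+ 2 / 4 : R) < t%:R)
    (y : K) (y_gt0 : 0 < iota y) (cubic_y : adjoin_degree 1%AS y = 3%N)
    (y_root : - 1 + t%:R * y + s%:R * y ^+ 2 + y ^+ 3 = 0)
    (f r : nat)
    (lt_norm : iota (y ^+ 2 + f%:R * y) <
       iota y * Num.sqrt `|f%:R ^+ 3 - s%:R * f%:R ^+ 2 + f%:R * t%:R + 1|)
    (lt_1 : iota (y ^+ 2 + f%:R * y) < 1) :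
  let v := vec3 (y ^+ 2 + f%:R * y + r%:R) y 1 in
  let per := [:: A_mx B1 t s; A_mx B3 t s; A_mx B2 s t] in
  ((0 < r)%N -> forall A : nat -> option 'M[K]_3,
     AJPA_expansion iota v A <->
     forall i, A i =
       Some (eventually_periodic [:: A_mx B3 r 0; A_mx B2 f t] per i)) /\
  (r = 0%N -> forall A : nat -> option 'M[K]_3,
     AJPA_expansion iota v A <->
     forall i, A i = Some (eventually_periodic [:: A_mx B2 f t] per i)).
Proof.
move=> v per.
have y1 := iota_root_lt1 iota s_gt0 lt_st y_root.
have z_gt0 : 0 < iota (y ^+ 2 + f%:R * y).
  by rewrite iota_sqr_add mulr_gt0 ?ltr_wpDr ?ler0n.
have I2 : I_set iota B2 f t (vec3 (y ^+ 2 + f%:R * y) y 1).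
  rewrite /I_set !mxE /= rmorph1; split=> //.
  have := I_cond_root cubicK s_gt0 lt_st y_gt0 cubic_y y_root 0 lt_norm lt_1.
  by rewrite expr0 !mul1r.
have M2 : A_mx B2 f t *m per_vec s y 0 = vec3 (y ^+ 2 + f%:R * y) y 1.
  rewrite /per_vec A_mxE expr1; congr vec3.
  rewrite -[RHS]addr0 -[X in _ = _ + X]y_root; ring.
have per_stp := per_step cubicK s_gt0 lt_st y_gt0 cubic_y y_root.
split=> [r_gt0 | r0].
  (* Two states precede the orbit, so the periodic index is shifted by two. *)
  pose w i := match i with
    | 0 => v | 1 => vec3 (y ^+ 2 + f%:R * y) y 1 | i.+2 => per_vec s y i end.
  apply: (@AJPA_expansionE _ _ iota w) => -[|[|i]].
  - exists B3, r, 0; split=> //=; last first.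
      by rewrite A_mxE mulr1 mul0r addr0.
    have r1 : 1 <= r%:R :> R by rewrite ler1n.
    rewrite /I_set !mxE /= rmorph1; split=> //; first last.
    + split; rewrite ?rmorph1 ?divr1.
      * by rewrite rmorphD rmorph_nat floor_addn // ltW.
      * by rewrite -[iota y]addr0 (floor_addn 0) // ltW.
      (* The first coordinate is the largest since [r >= 1]; [1] and [y] both have norm 1, so their
         scaled comparison is [y < 1]. *)
      right; split;
        rewrite ?rmorph1 ?[iota (_ + r%:R)]rmorphD ?rmorph_nat /=; try lra.
      have := scaled_rootX iota cubicK cubic_y y_root 1.
      have := scaled_rootX iota cubicK cubic_y y_root 0.
      by rewrite !expr0 !expr1 => -> ->.
    + by rewrite rmorphD rmorph_nat addr_gt0 // ltr0n.
  - by exists B2, f, t.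
  - by rewrite /eventually_periodic /= !subSS subn0; apply: per_stp.
(* For [r = 0] the initial vector is already the state of the [B2] step. *)
pose w i := if i is i.+1 then per_vec s y i else v.
have v0 : v = vec3 (y ^+ 2 + f%:R * y) y 1 by rewrite /v r0 addr0.
apply: (@AJPA_expansionE _ _ iota w) => -[|i].
  by exists B2, f, t; rewrite /= v0.
by rewrite /eventually_periodic /= subSS subn0; apply: per_stp.
Qed.
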